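(* Let $k\geq 2$ be an integer. Then, as an identity between formal power series, $$\log G_k = G_k^{\circ},$$ where $G_k(x)=1+\sum_{n\geq 1}\frac{x^n}{n}\binom{kn}{n-1}$ and $G_k^{\circ}(x)=\sum_{n\geq 1}\frac{x^n}{n!}\,|\mathscr P_k^{\circ}(n)|$ is the exponential generating function for $[n]$-labeled $k$-ornaments.
   Context: Here $\mathbb N=\{1,2,3,\dots\}$ and $[n]=\{1,\dots,n\}$. The logarithm of a formal power series with constant term $1$ is the usual formal logarithm. Labeled good paths: let $n\in\mathbb N$, $k\ge 2$, and let $V\subset\mathbb N$ be a finite set with $|V|=n$. A $V$-labeled $k$-good path is a lattice path in $\mathbb Z^2$ from $(0,0)$ to $(n,(k-1)n)$ with steps $(0,1)$ or $(1,0)$ that never rises above the line $y=(k-1)x$, together with a labeling, i.e. a bijection from the set of heights $\{(k-1)j : 0\le j\le n-1\}$ to $V$. The set of these is denoted $\mathscr P_k(V)$. Ornaments: for $P\in\mathscr P_k(V)$ let $\hat P$ be the labeled bi-infinite lattice path obtained by concatenating the translates $j(n,(k-1)n)+P$, $j\in\mathbb Z$, keeping the labelings (so height $(k-1)(jn+i)$, for $j\in\mathbb Z$ and $0\le i\le n-1$, carries the label that height $(k-1)i$ has in $P$). Two paths $P_1,P_2\in\mathscr P_k(V)$ are equivalent if and only if $\hat P_1$ is a translate of $\hat P_2$ along the line $y=(k-1)x$, including the labeling. The equivalence classes are called $V$-labeled $k$-ornaments; their set is denoted $\mathscr P_k^{\circ}(V)$, and $\mathscr P_k^{\circ}(n):=\mathscr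 P_k^{\circ}([n])$. *)

(* Defs.v *)
(* MathComp world, with classical sets for the bi-infinite paths. *)
From mathcomp Require Import all_boot all_order all_algebra.
From mathcomp Require Import finmap boolp classical_sets.

Set Implicit Arguments.
Unset Strict Implicit.
Unset Printing Implicit Defensive.

Import GRing.Theory.
Local Open Scope ring_scope.

(** * Formal power series over [rat], as coefficient sequences *)

Definition fps := nat -> rat.

Definition fps_one : fps := fun n => (n == 0%N)%:R.

Definition fps_sub (a b : fps) : fps := fun n => a n - b n.

Definition fps_mul (a b : fps) : fps :=
  fun n => \sum_(i < n.+1) a i * b (n - i)%N.

Definition fps_pow (a : fps) (m : nat) : fps := iter m (fps_mul a) fps_one.

(* log a = sum_{m >= 1} (-1)^(m-1) / m * (a - 1)^m for a with constant term 1.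
   By [fps_pow_eq0] the terms with m > n do not contribute to the coefficient
   of x^n, so that the sum is cut at m = n.  The value is meaningless when the
   constant term of a is not 1. *)
Definition fps_log (a : fps) : fps := fun n =>
  \sum_(1 <= m < n.+1)
     (-1) ^+ m.-1 / m%:R * fps_pow (fps_sub a fps_one) m n.

Lemma fps_pow_eq0 (a : fps) (m n : nat) :
  a 0%N = 0 -> (n < m)%N -> fps_pow a m n = 0.
Proof.
move=> a0; elim: m n => [|m IHm] n // lt_nm.
rewrite /fps_pow iterS -/(fps_pow a m) /fps_mul big1 // => -[[|i] lt_i] _ /=.
  by rewrite a0 mul0r.
have n_gt0 : (0 < n)%N by apply: leq_ltn_trans (leq0n i) _.
by rewrite IHm ?mulr0 // (@leq_trans n) // ltn_subrL.
Qed.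

(** * Labeled good paths *)

(* A lattice path starting at (0,0) is its sequence of steps: [true] is the
   step (1,0) and [false] the step (0,1). *)
Definition vertex (s : seq bool) (i : nat) : nat * nat :=
  (count id (take i s), count negb (take i s)).

(* The half-plane y <= (k-1)x is convex, so a path stays in it as soon as its
   vertices do. *)
Definition good_path (k n : nat) (s : seq bool) : bool :=
  (vertex s (size s) == (n, (k.-1 * n)%N)) &&
  [forall i : 'I_(size s).+1, (vertex s i).2 <= k.-1 * (vertex s i).1]%N.

(* Steps together with labels; for i < n the second component sends i to the
   label of the height (k-1)i. *)
Definition labeled_path (k n : nat) (V : finType) : finType :=
  ((n + k.-1 * n).-tuple bool * {ffun 'I_n -> V})%type.

Definition good_paths (k n : nat) (V : finType) : {set labeled_path k n V} :=
  [set P : labeled_path k n V | good_path k n P.1 & `[< bijective P.2 >]].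

(** * Ornaments *)

(* The bi-infinite labeled path obtained from P.  A bi-infinite path with steps
   (1,0) and (0,1) is determined by the set of its vertices, and its labeling
   by the set of pairs (height, label). *)
Definition hat_vertices (k n : nat) (V : finType) (P : labeled_path k n V) :
    set (int * int) :=
  [set z | exists (j : int) (i : nat), (i <= size P.1)%N /\
     z = (j * n%:Z + (vertex P.1 i).1%:Z,
          j * (k.-1 * n)%:Z + (vertex P.1 i).2%:Z)]%classic.

Definition hat_labels (k n : nat) (V : finType) (P : labeled_path k n V) :
    set (int * V) :=
  [set z | exists (j : int) (i : 'I_n),
     z = (k.-1%:Z * (j * n%:Z + (i : nat)%:Z), P.2 i)]%classic.

(* Both paths visit lattice points only, so the translations along the line
   y = (k-1)x to consider are those by (t, (k-1)t) with t an integer. *)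
Definition path_equiv (k n : nat) (V : finType) (P1 P2 : labeled_path k n V) :
    Prop :=
  exists t : int,
    hat_vertices P1 =
      [set (z.1 + t, z.2 + k.-1%:Z * t) | z in hat_vertices P2]%classic /\
    hat_labels P1 =
      [set (z.1 + k.-1%:Z * t, z.2) | z in hat_labels P2]%classic.

Definition ornaments (k : nat) (V : {fset nat}) :
    {set {set labeled_path k #|` V| V}} :=
  equivalence_partition (fun P1 P2 => `[< path_equiv P1 P2 >])
    (good_paths k #|` V| V).

Definition first_labels (n : nat) : {fset nat} := [fset i in iota 1 n]%fset.

(** * The two generating functions *)

Definition G (k : nat) : fps := fun n =>
  if n == 0%N then 1 else 'C(k * n, n.-1)%:R / n%:R.

Definition G_circ (k : nat) : fps := fun n =>
  if n == 0%N then 0 else #|ornaments k (first_labels n)|%:R / (n`!)%:R.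

(* Main.v *)
(* Both sides have n-th coefficient 'C(kn, n) / (kn) for n >= 1.

   Logarithm: x G' = x (log G)' G determines log G, so it suffices to check
   k n G_n = sum_(j >= 1) 'C(kj, j) G_(n-j), an instance of the Rothe-Hagen
   convolution sum_j a_j(x) 'C(y + k(n-j), n-j) = 'C(x+y+kn, n), where
   a_j(x) = 'C(x+kj, j) x / (x+kj) and a_j(1) = G_j.  That identity follows by
   induction on n and x from the Pascal rule for both factors.

   Ornaments: the class of a labeled good path P consists of the rotations of
   P that are again good, one for each return of P to the line, and these are
   distinct because the labels are.  So the number of ornaments is n! times the
   sum over good paths s of 1 / (number of good rotations of s).  That number is
   invariant under rotation, and every sequence of n east and (k-1)n north
   steps has a good rotation (start it where it is highest above the line), so
   counting pairs (sequence, good rotation) shows that this sum is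
   'C(kn, n) / (kn). *)
Require Import Defs.
From mathcomp Require Import finmap boolp classical_sets.
From mathcomp Require Import all_boot all_order all_algebra.
From mathcomp Require Import ring zify lra.

Set Implicit Arguments.
Unset Strict Implicit.
Unset Printing Implicit Defensive.

Import Order.TTheory GRing.Theory Num.Theory.
Local Open Scope ring_scope.

(** * The logarithm via its derivative *)

(** Truncation turns powers of series into powers in [{poly rat}], where derivatives and geometric
    sums can be used. *)
Lemma fps_pow_poly (a : fps) (N m i : nat) :
  (i <= N)%N -> fps_pow a m i = ((\poly_(j < N.+1) a j) ^+ m)`_i.
Proof.
elim: m i => [|m IHm] i le_iN; first by rewrite expr0 coef1.
rewrite /fps_pow iterS -/(fps_pow a m) exprS coefM /fps_mul.
apply: eq_bigr => j _; rewrite coef_poly ltnS.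
have le_ji : (j <= i)%N by rewrite -ltnS.
by rewrite (leq_trans le_ji le_iN) IHm // (leq_trans (leq_subr _ _)).
Qed.

(* The coefficient form of x a' = x (log a)' a. *)
Lemma fps_log_deriv (a : fps) (n : nat) : a 0%N = 1 ->
  n%:R * a n = \sum_(i < n.+1) i%:R * fps_log a i * a (n - i)%N.
Proof.
move=> a0; rewrite big_ord_recl !mul0r add0r.
case: n => [|n]; first by rewrite mul0r big_ord0.
pose u := fps_sub a fps_one; pose p := \poly_(j < n.+2) u j.
have u0 : u 0%N = 0 by rewrite /u /fps_sub a0 subrr.
(* [q] is the logarithm of [1 + p] with its series cut after degree n+1 in [p]. *)
pose q := \sum_(1 <= m < n.+2) ((-1) ^+ m.-1 / m%:R) *: p ^+ m.
have qE i : (i <= n.+1)%N -> fps_log a i = q`_i.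
  move=> le_in; rewrite coef_sum /fps_log [RHS](@big_cat_nat _ _ _ i.+1) //=.
  rewrite [X in _ = _ + X]big_nat_cond [X in _ = _ + X]big1 ?addr0.
    by apply: eq_bigr => m _; rewrite coefZ (fps_pow_poly _ _ le_in).
  move=> m /andP[/andP[lt_im _] _].
  by rewrite coefZ -(fps_pow_poly _ _ le_in) fps_pow_eq0 ?mulr0.
(* The derivative of [q] is p' times a geometric sum in -p, which [1 + p] telescopes. *)
have dq : q^`() * (1 + p) = p^`() * (1 - (- p) ^+ n.+1).
  rewrite -[1 - _]opprB subrX1 -opprD mulNr opprK [p + 1]addrC mulrA mulrAC.
  rewrite /q big_add1 /= big_mkord raddf_sum mulr_sumr; congr (_ * _).
  apply: eq_bigr => m _.
  rewrite /= derivZ deriv_exp -scaler_nat scalerA divfK ?pnatr_eq0 //.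
  by rewrite [(- p) ^+ m]exprNn -(signr_odd {poly rat}) -(signr_odd rat)
    mulr_sign scaler_sign; case: ifP; rewrite ?mulrN.
(* The remainder has order at least n+1, so it does not reach the coefficient of degree n. *)
have pnE i : (i < n.+1)%N -> ((- p) ^+ n.+1)`_i = 0.
  move=> lt_in; rewrite exprNn -signr_odd mulr_sign.
  have : (p ^+ n.+1)`_i = 0.
    by rewrite -(@fps_pow_poly _ _ _ _ (ltnW lt_in)) fps_pow_eq0.
  by case: ifP => _; rewrite ?coefN => ->; rewrite ?oppr0.
have : (q^`() * (1 + p))`_n = (n.+1)%:R * a n.+1.
  rewrite dq mulrBr mulr1 coefB coef_deriv coef_poly ltnSn coefM big1 ?subr0.
    by rewrite /u /fps_sub /fps_one subr0 mulr_natl.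
  by move=> i _; rewrite pnE ?mulr0 // ltnS leq_subr.
move <-; rewrite coefM; apply: eq_bigr => i _.
rewrite coef_deriv qE ?lift0 // subSS mulr_natl; congr (_ * _).
rewrite coefD coef1 coef_poly ltnS (leq_trans (leq_subr _ _)) //.
by rewrite /u /fps_sub /fps_one addrC subrK.
Qed.

(** As the constant term of [a] is 1, the last summand is [n%:R * l n] and the others involve only
    earlier values of [l]: the recurrence determines [l]. *)
Lemma fps_log_unique (a l : fps) : a 0%N = 1 -> l 0%N = 0 ->
  (forall n, n%:R * a n = \sum_(i < n.+1) i%:R * l i * a (n - i)%N) ->
  fps_log a =1 l.
Proof.
move=> a0 l0 al n; elim/ltn_ind: n => -[|n] IHn;
  first by rewrite /fps_log big_nil.
have := al n.+1; rewrite fps_log_deriv //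
  big_ord_recr [X in _ = X -> _]big_ord_recr /= subnn a0 !mulr1.
under eq_bigr => i _ do rewrite (IHn _ (ltn_ord i)).
by move/addrI; apply: mulfI; rewrite pnatr_eq0.
Qed.

(** * The Rothe-Hagen convolution and the logarithm of [G] *)

(* [a_j(x) = 'C(x + k j, j) x / (x + k j)], written without the division. *)
Definition rothe (k x j : nat) : rat :=
  if j is i.+1 then 'C(x + k * j, j)%:R - k%:R * 'C((x + k * j).-1, i)%:R
  else 1.

Arguments rothe : simpl never.

Lemma rothe0 (k j : nat) : (0 < k)%N -> rothe k 0 j = (j == 0%N)%:R.
Proof.
case: k j => // k [|j] // _; rewrite /rothe add0n.
apply/eqP; rewrite subr_eq0 -natrM eqr_nat -(eqn_pmul2l (ltn0Sn j)).
by rewrite -mul_bin_diag mulnA [(j.+1 * _)%N]mulnC.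
Qed.

(** Pascal's rule splits both binomials; the terms of lower index form a_j(x+k), because x + k(j+1)
    = (x+k) + kj. *)
Lemma rotheS (k x j : nat) : (0 < k)%N ->
  rothe k x.+1 j.+1 = rothe k x j.+1 + rothe k (x + k) j.
Proof.
case: k => // k _; rewrite /rothe.
case: j => [|j].
  by rewrite !bin1 !bin0 muln1 addSn -natr1; ring.
have -> : (x.+1 + k.+1 * j.+2)%N = (x + k.+1 + k.+1 * j.+1).+1 by lia.
have -> : (x + k.+1 * j.+2)%N = (x + k + k.+1 * j.+1).+1 by lia.
have -> : (x + k.+1 + k.+1 * j.+1)%N = (x + k + k.+1 * j.+1).+1 by lia.
by rewrite [_.-1]/= [_.-1]/= !binS !natrD; ring.
Qed.

(** By [rotheS] the sum at (x+1, n+1) is the sum at (x, n+1) plus the one at (x+k, n), and Pascal's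
    rule splits the right side alike. The second term needs the induction on n to be uniform in
    x. *)
Lemma rothe_convolution (k x y n : nat) : (0 < k)%N ->
  \sum_(j < n.+1) rothe k x j * 'C(y + k * (n - j), n - j)%:R
  = 'C(x + y + k * n, n)%:R.
Proof.
move=> k_gt0; elim: n x => [|n IHn] x; first by rewrite big_ord1 !bin0 mulr1.
elim: x => [|x IHx].
  rewrite big_ord_recl big1 => [|j _]; rewrite ?rothe0 ?lift0 //=.
    by rewrite mul1r addr0 subn0.
  by rewrite mul0r.
rewrite big_ord_recl.
under eq_bigr => j _ do rewrite lift0 rotheS // mulrDl subSS.
rewrite big_split IHn addrA.
move: IHx; rewrite big_ord_recl => IHx; rewrite [X in X + _]IHx.
have -> : (x.+1 + y + k * n.+1)%N = (x + y + k * n.+1).+1 by lia.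
by rewrite binS natrD; congr (_ + _%:R); congr ('C(_, _)); lia.
Qed.

Lemma rothe1_G (k j : nat) : rothe k 1 j = G k j.
Proof.
case: j => [|j] //; rewrite /rothe /G [_ == _]/= [_.+1.-1]/= add1n [_.+1.-1]/=.
apply: (mulIf (_ : (j.+1)%:R != 0 :> rat)); first by rewrite pnatr_eq0.
have := mul_bin_diag (k * j.+1).+1 j; move/(congr1 (fun m => m%:R : rat)).
rewrite !natrM /= -natr1 natrM => E.
by rewrite divfK ?pnatr_eq0 // mulrBl [X in X - _]mulrC -E; ring.
Qed.

Lemma log_G (k n : nat) : (0 < k)%N ->
  fps_log (G k) n = if n == 0%N then 0 else 'C(k * n, n)%:R / (k * n)%:R.
Proof.
move=> k_gt0.
apply: (@fps_log_unique _
  (fun n => if n == 0%N then 0 else 'C(k * n, n)%:R / (k * n)%:R)) => // {}n.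
have kn0 : k%:R != 0 :> rat by rewrite pnatr_eq0 -lt0n.
apply: (mulfI kn0).
have H := @rothe_convolution k 1 0 n k_gt0.
(* Reversing the sum gives index n-j to [rothe]; the term j = 0 is then G_n alone. *)
move: H; rewrite (reindex_inj rev_ord_inj) big_ord_recl /=
  subSS subn0 subnn muln0 bin0 mulr1.
rewrite rothe1_G addn0 add1n => H.
have En : 'C((k * n).+1, n)%:R = (k * n).+1%:R * G k n.
  rewrite -rothe1_G; case: n {H} => [|n]; first by rewrite bin0 muln0 mul1r.
  rewrite rothe1_G /G /=; apply: (mulIf (_ : (n.+1)%:R != 0 :> rat));
    first by rewrite pnatr_eq0.
  by rewrite -mulrA divfK ?pnatr_eq0 // -!natrM mulnC -mul_bin_diag.
rewrite mulrA -natrM.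
have -> : (k * n)%:R * G k n = 'C((k * n).+1, n)%:R - G k n.
  by rewrite En -natr1; ring.
(* Subtracting G_n removes the term j = 0 of the convolution, matching the factor i = 0 of the
   goal. *)
rewrite -H addrAC subrr add0r big_ord_recl !mul0r add0r mulr_sumr.
apply: eq_bigr => i _; rewrite rothe1_G /= /bump leq0n /=
  add1n add0n !subSS subKn //.
by rewrite mulrC natrM; field; rewrite kn0 nat1r pnatr_eq0.
Qed.

(** * Averaging over cyclic rotations *)

(* Both sides, multiplied by N, are the sum of 1 / #{r | rot r x in A} over the
   pairs (x, r) with rot r x in A. *)
Lemma card_rotations (T : finType) (N : nat) (X A : {set N.-tuple T}) :
    (0 < N)%N -> A \subset X ->
    (forall r (x : N.-tuple T), ([tuple of rot r x] \in X) = (x \in X)) ->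
    (forall x : N.-tuple T, x \in X ->
      exists r : 'I_N, [tuple of rot r x] \in A) ->
  \sum_(y in A) (#|[set r : 'I_N | [tuple of rot r y] \in A]|%:R)^-1
    = #|X|%:R / N%:R :> rat.
Proof.
case: N X A => // N X A _ sAX Xrot Arot.
pose R (y : N.+1.-tuple T) := [set r : 'I_N.+1 | [tuple of rot r y] \in A].
(* Rotations compose as addition in the cyclic group ['I_N.+1]. *)
have rot_ord (q r : 'I_N.+1) (x : N.+1.-tuple T) :
    [tuple of rot q [tuple of rot r x]] = [tuple of rot (q + r : 'I_N.+1)%R x].
  apply: val_inj => /=; rewrite rot_add_mod ?size_tuple ?(ltnW (ltn_ord _)) //.
  case: ltngtP => [lt_N|lt_N|->];
    last by rewrite modnn -{1}(size_tuple x) rot_size rot0.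
    by rewrite modn_small.
  rewrite -[in RHS](subnK (ltnW lt_N)) modnDr modn_small //.
  by rewrite ltn_subLR ?(ltnW lt_N) // -addnS leq_add // ltnW.
have R_rot (r : 'I_N.+1) (x : N.+1.-tuple T) : #|R [tuple of rot r x]| = #|R x|.
  rewrite -[in RHS](card_imset _ (addIr (- r))); congr #|pred_of_set _|.
  apply/setP => q; rewrite inE rot_ord; apply/idP/imsetP => [qA|[s]].
    by exists (q + r); rewrite ?addrK // inE.
  by rewrite inE => sA ->; rewrite subrK.
have N0 : N.+1%:R != 0 :> rat by rewrite pnatr_eq0.
apply: (mulIf N0); rewrite divfK // mulr_natr; set S := \sum_(y in A) _.
have -> : S *+ N.+1 = \sum_(r : 'I_N.+1) S by rewrite sumr_const card_ord.
transitivity (\sum_(x in X) \sum_(r in R x) (#|R [tuple of rot r x]|%:R)^-1 :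
  rat).
  (* For fixed r, the substitution of [rot r x] for y turns the sum over x into S. *)
  apply/esym; rewrite (exchange_big_dep predT) //=; apply: eq_bigr => r _.
  have rot_inj : injective (fun x : N.+1.-tuple T => [tuple of rot r x]).
    by move=> x y /(congr1 val) /= /rot_inj /val_inj.
  rewrite /S [RHS](reindex_inj rot_inj) /=; apply: eq_bigl => x.
  rewrite inE; apply/andP/idP => [[]|xA] //; split=> //.
  by rewrite -(Xrot r) (subsetP sAX).
(* For fixed x, the inner sum has #|R x| equal terms, hence is 1; R x is nonempty by [Arot]. *)
rewrite -sum1_card natr_sum; apply: eq_bigr => x /Arot[r rA].
under eq_bigr => q _ do rewrite R_rot.
rewrite sumr_const -[LHS]mulr_natl divff // pnatr_eq0 -lt0n card_gt0.
by apply/set0Pn; exists r; rewrite inE.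
Qed.

(** * East steps along the periodic path and good rotations *)

(** Indices are taken modulo [size s], so the count runs along the periodic repetition of [s], and a
    rotation becomes a shift of the argument ([east_rot]). *)
Definition east (s : seq bool) (m : nat) : nat :=
  \sum_(0 <= l < m) nth false s (l %% size s).

Lemma eastS s m : east s m.+1 = (east s m + nth false s (m %% size s))%N.
Proof. by rewrite /east big_nat_recr. Qed.

Lemma east0 s : east s 0 = 0%N.
Proof. by rewrite /east big_nil. Qed.

Lemma east_count s m : (m <= size s)%N -> east s m = count id (take m s).
Proof.
elim: m => [|m IHm] lt_ms; first by rewrite east0 take0.
rewrite eastS IHm ?(ltnW lt_ms) // modn_small // (take_nth false) //.
by rewrite -cats1 count_cat /= addn0.
Qed.

Lemma eastD s m : east s (size s + m) = (count id s + east s m)%N.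
Proof.
elim: m => [|m IHm].
  by rewrite addn0 east_count // take_size east0 addn0.
by rewrite addnS !eastS IHm modnDl addnA.
Qed.

Lemma nth_rot_mod (T : Type) (x0 : T) s r m : (r <= size s)%N ->
  nth x0 (rot r s) (m %% size s) = nth x0 s ((r + m) %% size s).
Proof.
case: s => [|y s] le_rs; first by rewrite /rot /= !nth_nil.
rewrite /rot nth_cat size_drop -(modnDmr r m); set i := (m %% _)%N.
have lt_i : (i < size (y :: s))%N by rewrite ltn_mod.
case: ltnP => [lt_ir|le_ri].
  by rewrite nth_drop modn_small // -ltn_subRL.
rewrite nth_take; last by lia.
congr nth; have -> : (r + i = i - (size (y :: s) - r) + size (y :: s))%N by lia.
by rewrite modnDr modn_small //; lia.
Qed.

Lemma east_rot s r m : (r <= size s)%N ->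
  east s (r + m) = (east s r + east (rot r s) m)%N.
Proof.
move=> le_rs; elim: m => [|m IHm]; first by rewrite addn0 east0 addn0.
by rewrite addnS !eastS IHm size_rot nth_rot_mod // addnA.
Qed.

Lemma count_take_negb (s : seq bool) m : (m <= size s)%N ->
  count negb (take m s) = (m - east s m)%N.
Proof.
move=> le_ms; rewrite east_count //.
have := count_predC id (take m s); rewrite size_takel //.
by rewrite (eq_count (_ : predC id =1 negb)) //; lia.
Qed.

Lemma east_le s m : (east s m <= m)%N.
Proof.
by elim: m => [|m IHm]; rewrite ?east0 // eastS -addn1 leq_add // leq_b1.
Qed.

Lemma eq_east (s1 s2 : seq bool) :
  size s1 = size s2 -> east s1 =1 east s2 -> s1 = s2.
Proof.
move=> sz e12; apply: (@eq_from_nth _ false) => // i lt_i.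
have := e12 i.+1; rewrite !eastS e12 !modn_small -?sz // => /addnI.
by case: nth; case: nth.
Qed.

(** With e east steps among m, the condition m - e <= (k-1)e reads m <= ke. It extends to all m
    because a period adds kn to both sides. *)
Lemma good_pathP (k n : nat) (s : seq bool) :
  (0 < k)%N -> (0 < n)%N -> size s = (k * n)%N ->
  reflect (count id s = n /\ forall m, m <= k * east s m)%N (good_path k n s).
Proof.
move=> k_gt0 n_gt0 sz.
have vE m : (m <= size s)%N -> vertex s m = (east s m, m - east s m)%N.
  by move=> le_m; rewrite /vertex -east_count // count_take_negb.
have below m : (m <= size s)%N ->
    ((vertex s m).2 <= k.-1 * (vertex s m).1)%N = (m <= k * east s m)%N.
  by move=> /vE -> /=; rewrite leq_subLR -mulSn prednK.
apply: (iffP andP) => [[/eqP v /forallP H]|[ct H]]; last first.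
  split; last by apply/forallP => i; rewrite below // -ltnS.
  rewrite vE // east_count // take_size ct sz; apply/eqP; congr (_, _).
  by rewrite -[X in (X * n - _)%N](prednK k_gt0) mulSn addKn.
have ct : count id s = n by move: v; rewrite /vertex take_size => -[].
split=> //; elim/ltn_ind => m IHm; have [lt_ms|le_sm] := ltnP m (size s).
  by rewrite -below ?(ltnW lt_ms) //;
    exact: (H (Ordinal (ltnW lt_ms : m < (size s).+1)%N)).
have s_gt0 : (0 < size s)%N by rewrite sz muln_gt0 k_gt0.
rewrite -(subnKC le_sm) eastD ct mulnDr -sz leq_add2l IHm //.
by rewrite ltn_subrL s_gt0 (leq_trans s_gt0).
Qed.

Lemma count_rot (T : Type) (p : pred T) r (s : seq T) :
  count p (rot r s) = count p s.
Proof. by rewrite -{2}(cat_take_drop r s) !count_cat addnC. Qed.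

Lemma exists_good_rot (k n : nat) (s : seq bool) : (0 < k)%N -> (0 < n)%N ->
  size s = (k * n)%N -> count id s = n ->
  exists2 r, (r < size s)%N & good_path k n (rot r s).
Proof.
move=> k_gt0 n_gt0 sz ct.
have s_gt0 : (0 < size s)%N by rewrite sz muln_gt0 k_gt0.
(* [h m] is (k-1)x - y at the m-th vertex. It is periodic, so a minimum over one period is global,
   and a path started there never rises above the line. *)
pose h m : int := (k * east s m)%N%:Z - m%:Z.
have h_mod m : h (m %% size s)%N = h m.
  elim/ltn_ind: m => m IHm; have [lt_ms|le_sm] := ltnP m (size s).
    by rewrite modn_small.
  rewrite -(subnKC le_sm) modnDl IHm;
    last by rewrite ltn_subrL s_gt0 (leq_trans s_gt0).
  by rewrite /h eastD ct mulnDr -sz; lia.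
case: (@arg_minP _ _ _ (Ordinal s_gt0) xpredT
  (fun m : 'I_(size s) => h m)) => // r _ r_min.
exists r => //; apply/good_pathP; rewrite ?size_rot // count_rot; split=> // m.
have := r_min (Ordinal (ltn_pmod (r + m)%N s_gt0)) isT.
by rewrite /= h_mod /h (east_rot _ (ltnW (ltn_ord r))) mulnDr; lia.
Qed.

(** The equation puts vertex r on the line. If the rotation is good, its bound after [size s - r]
    steps gives k e_r <= r, and goodness of [s] gives the converse inequality. *)
Lemma good_rotP (k n r : nat) (s : seq bool) : (0 < k)%N -> (0 < n)%N ->
  size s = (k * n)%N -> (r <= size s)%N -> good_path k n s ->
  good_path k n (rot r s) = (k * east s r == r)%N.
Proof.
move=> k_gt0 n_gt0 sz le_rs /good_pathP[] // ct s_good.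
apply/good_pathP/eqP; rewrite ?size_rot // count_rot.
  case=> _ /(_ (size s - r)%N) r_good; apply/eqP; rewrite eqn_leq s_good andbT.
  move: r_good; have := east_rot (size s - r) le_rs.
  by rewrite subnKC // east_count // take_size ct; move: le_rs; rewrite sz; lia.
move=> Er; split=> // m; have := s_good (r + m)%N.
by rewrite east_rot // mulnDr Er leq_add2l.
Qed.

(** * Counting tools *)

Lemma card_count_tuple (N n : nat) :
  #|[set x : N.-tuple bool | count id x == n]| = 'C(N, n).
Proof.
rewrite -[X in 'C(X, _)](card_ord N) -card_draws.
pose f (x : N.-tuple bool) := [set i | tnth x i].
have f_inj : injective f.
  by move=> x y /setP xy; apply: eq_from_tnth => i; have := xy i; rewrite !inE.
rewrite -(card_imset _ f_inj); congr #|pred_of_set _|; apply/setP => B.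
have cardf x : #|f x| = count id x.
  rewrite -sum1_count big_tuple -sum1_card; apply: eq_bigl => i.
  by rewrite inE.
rewrite inE; apply/imsetP/eqP => [[x]|cardB].
  by rewrite inE => /eqP <- ->; rewrite cardf.
have fB : B = f [tuple i \in B | i < N].
  by apply/setP => i; rewrite inE tnth_mktuple.
by exists [tuple i \in B | i < N]; rewrite // inE -cardf -fB cardB.
Qed.

(** Each class B contributes #|B| terms, all equal to 1 / #|B|. *)
Lemma card_equivalence_partition (T : finType) (R : rel T) (D : {set T}) :
    {in D & &, equivalence_rel R} ->
  #|equivalence_partition R D|%:R
    = \sum_(x in D) (#|[set y in D | R x y]|%:R)^-1 :> rat.
Proof.
move=> eqvR; rewrite (set_partition_big _ (equivalence_partitionP eqvR)) /=.
rewrite -sum1_card natr_sum; apply: eq_bigr => _ /imsetP[x xD ->].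
set B := [set y in D | R x y].
have xB : x \in B by rewrite inE xD; case: (eqvR x x x xD xD xD).
rewrite (eq_bigr (fun=> (#|B|%:R)^-1)).
  by rewrite sumr_const -[RHS]mulr_natl divff // pnatr_eq0 -lt0n card_gt0;
    apply/set0Pn; exists x.
move=> y; rewrite inE => /andP[yD Rxy]; congr (#|pred_of_set _|%:R^-1).
apply/setP => z; rewrite !inE; case zD: (z \in D) => //=.
by case: (eqvR x y z xD yD zD) => _ /(_ Rxy) ->.
Qed.

(** * Bi-infinite paths and rotations of labeled paths *)

(** A position on the bi-infinite path is a block j, possibly negative, and an offset m that may
    exceed a period; its abscissa does not depend on this choice. *)
Lemma east_period (s : seq bool) (m1 m2 : nat) (j1 j2 : int) :
  m1%:Z + j1 * (size s)%:Z = m2%:Z + j2 * (size s)%:Z ->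
  (east s m1)%:Z + j1 * (count id s)%:Z = (east s m2)%:Z + j2 * (count id s)%:Z.
Proof.
have eastMD q m : east s (q * size s + m) = (q * count id s + east s m)%N.
  by elim: q => // q IHq; rewrite !mulSn -!addnA eastD IHq.
wlog le_j : m1 m2 j1 j2 / j2 <= j1 => [H|].
  by case/orP: (le_total j2 j1) => le_j; [|move=> /esym]; move/H; move/(_ le_j).
have [q ->] : exists q : nat, j1 = j2 + q%:Z by exists `|j1 - j2|%N; lia.
move=> E; have -> : m2 = (q * size s + m1)%N by lia.
by rewrite eastMD; lia.
Qed.

Lemma modn_int (n x i : nat) (q : int) :
  (i < n)%N -> x%:Z = q * n%:Z + i%:Z -> (x %% n)%N = i.
Proof.
move=> lt_in; case: q => [q|q] E; last by exfalso; nia.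
have -> : x = (q * n + i)%N by lia.
by rewrite modnMDl modn_small.
Qed.

Definition ord_shift (n a : nat) (i : 'I_n) : 'I_n :=
  Ordinal (ltn_pmod (i + a) (leq_ltn_trans (leq0n i) (ltn_ord i))).

Lemma ord_shift_inj (n a : nat) : injective (@ord_shift n a).
Proof.
move=> i j /(congr1 val) /= /eqP; rewrite eqn_modDr !modn_small // => /eqP.
exact: val_inj.
Qed.

(** A vertex r on the line has height (k-1) times [east P.1 r], so the label indices move by
    [east P.1 r]. *)
Definition shift_path (k n : nat) (V : finType) (P : labeled_path k n V)
    (r : nat) :
    labeled_path k n V :=
  ([tuple of rot r P.1], [ffun i => P.2 (ord_shift (east P.1 r) i)]).

Section Ornaments.
Variables (k n : nat) (V : finType).
Hypotheses (k_gt1 : (1 < k)%N) (n_gt0 : (0 < n)%N).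
Implicit Types P : labeled_path k n V.

Let k_gt0 : (0 < k)%N. Proof. exact: ltnW. Qed.

Lemma size_path P : size P.1 = (k * n)%N.
Proof. by rewrite size_tuple -mulSn prednK. Qed.

Lemma good_path_count P : good_path k n P.1 -> count id P.1 = n.
Proof. by case/(good_pathP k_gt0 n_gt0 (size_path P)). Qed.

(** A vertex is given by x and by x + y, its position along the path. Leaving m unbounded avoids
    reductions modulo the length later. *)
Lemma hat_verticesP P z : count id P.1 = n ->
  hat_vertices P z <-> exists (j : int) (m : nat),
    z.1 = j * n%:Z + (east P.1 m)%:Z /\ z.1 + z.2 = j * (k * n)%N%:Z + m%:Z.
Proof.
move=> ct; have vE i : (i <= size P.1)%N ->
    vertex P.1 i = (east P.1 i, i - east P.1 i)%N.
  by move=> le_i; rewrite /vertex -east_count // count_take_negb.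
have kE : (k * n = n + k.-1 * n)%N by rewrite -mulSn prednK.
split=> [[j [i [le_i ->]]]|[j [m [z1 z2]]]].
  exists j, i; rewrite vE //=; split=> //.
  by rewrite kE PoszD mulrDr -subzn ?east_le //; ring.
have s_gt0 : (0 < size P.1)%N by rewrite size_path muln_gt0 k_gt0.
have [q [r [lt_r Em]]] :
  exists q r, (r < size P.1)%N /\ m = (q * size P.1 + r)%N.
  by exists (m %/ size P.1)%N, (m %% size P.1)%N; rewrite ltn_mod -divn_eq.
exists (j + q%:Z), r; split; first exact: ltnW.
have Ee : (east P.1 m)%:Z = q%:Z * n%:Z + (east P.1 r)%:Z.
  have := @east_period P.1 m r 0 q; rewrite ct !mul0r !addr0 => -> //.
    exact: addrC.
  by rewrite Em PoszD PoszM addrC.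
move: z2; rewrite vE ?(ltnW lt_r) //= -subzn ?east_le // Em size_path kE.
case: z z1 => a b /= ->; rewrite Ee => z2; congr (_, _); first by ring.
by apply: (addrI (j * n%:Z + (q%:Z * n%:Z + (east P.1 r)%:Z))); rewrite z2; ring.
Qed.

Lemma path_equivP P1 P2 : path_equiv P1 P2 <-> exists t : int,
  (forall z, hat_vertices P1 z <->
     hat_vertices P2 (z.1 - t, z.2 - k.-1%:Z * t)) /\
  (forall z, hat_labels P1 z <-> hat_labels P2 (z.1 - k.-1%:Z * t, z.2)).
Proof.
split=> -[t [Hv Hl]]; exists t; split.
- move=> z; rewrite Hv; split=> [[w hw <-]|hz].
    by rewrite /= !addrK -surjective_pairing.
  by exists (z.1 - t, z.2 - k.-1%:Z * t);
    rewrite //= !subrK -surjective_pairing.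
- move=> z; rewrite Hl; split=> [[w hw <-]|hz].
    by rewrite /= !addrK -surjective_pairing.
  by exists (z.1 - k.-1%:Z * t, z.2); rewrite //= !subrK -surjective_pairing.
- apply/seteqP; split=> z; rewrite /= Hv.
    by exists (z.1 - t, z.2 - k.-1%:Z * t);
      rewrite //= !subrK -surjective_pairing.
  by case=> w hw <-; rewrite /= !addrK -surjective_pairing.
- apply/seteqP; split=> z; rewrite /= Hl.
    by exists (z.1 - k.-1%:Z * t, z.2); rewrite //= !subrK -surjective_pairing.
  by case=> w hw <-; rewrite /= !addrK -surjective_pairing.
Qed.

Lemma path_equiv_sym P1 P2 : path_equiv P1 P2 -> path_equiv P2 P1.
Proof.
rewrite !path_equivP => -[t [Hv Hl]]; exists (- t); split=> z;
  rewrite ?Hv ?Hl /=.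
  by rewrite !mulrN !opprK !addrK -surjective_pairing.
by rewrite !mulrN !opprK !addrK -surjective_pairing.
Qed.

Lemma path_equiv_trans P1 P2 P3 :
  path_equiv P1 P2 -> path_equiv P2 P3 -> path_equiv P1 P3.
Proof.
rewrite !path_equivP => -[t [Hv Hl]] [u [Hv' Hl']]; exists (t + u); split=> z.
  by rewrite Hv Hv' /= mulrDr !opprD !addrA.
by rewrite Hl Hl' /= mulrDr !opprD !addrA.
Qed.

Lemma path_equiv_equivalence :
  {in good_paths k n V & &,
     equivalence_rel (fun P1 P2 => `[< path_equiv P1 P2 >])}.
Proof.
move=> P1 P2 P3 _ _ _; split.
  apply/asboolP/path_equivP; exists 0.
  by split=> z; rewrite mulr0 !subr0 -surjective_pairing.
move=> /asboolP P12; apply/asboolP/asboolP; apply: path_equiv_trans => //.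
exact: path_equiv_sym.
Qed.

Lemma hat_labels_shift P r z : (east P.1 r <= n)%N ->
  hat_labels (shift_path P r) z <->
  hat_labels P (z.1 + k.-1%:Z * (east P.1 r)%:Z, z.2).
Proof.
set a := east P.1 r => le_an; split=> [[j [i ->]]|[j [i]]] /=.
  exists (j + ((i + a) %/ n)%N%:Z), (ord_shift a i).
  rewrite ffunE /=; congr (_, _); rewrite -mulrDr; congr (_ * _).
  by have := divn_eq (i + a) n; lia.
case: z => y v /= [Ey ->].
(* Shifting by n - a undoes the shift by a; the block j - 1 makes up for the extra n. *)
exists (j - 1 + ((i + (n - a)) %/ n)%N%:Z), (ord_shift (n - a) i).
have Ei : ord_shift a (ord_shift (n - a) i) = i.
  apply: val_inj; rewrite /= modnDml -addnA subnK // modnDr modn_small //.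
rewrite ffunE Ei; congr (_, _); apply: (addIr (k.-1%:Z * a%:Z)).
rewrite Ey -mulrDr; congr (_ * _) => /=.
by have := divn_eq (i + (n - a)) n; lia.
Qed.

Lemma hat_vertices_shift P r z : good_path k n P.1 -> (r <= size P.1)%N ->
  (k * east P.1 r)%N = r ->
  hat_vertices (shift_path P r) z <->
  hat_vertices P (z.1 + (east P.1 r)%:Z, z.2 + k.-1%:Z * (east P.1 r)%:Z).
Proof.
move=> /good_path_count ct le_r Er.
have kE : k%:Z = k.-1%:Z + 1 by lia.
have EL := Er; move: EL => /(congr1 Posz); rewrite PoszM kE => EL.
rewrite !hat_verticesP ?count_rot //=; split=> -[j [m [z1 z2]]].
  exists j, (r + m)%N; rewrite east_rot //; split; first by lia.
  rewrite PoszD; lra.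
(* A period is added to keep m - r nonnegative, and j - 1 takes it back. *)
have [q Eq] :
  exists q, (m + size P.1 = r + q)%N by exists (m + size P.1 - r)%N; lia.
exists (j - 1), q; have := east_rot q le_r.
rewrite -Eq [(m + size P.1)%N]addnC eastD ct => /(congr1 Posz);
  rewrite !PoszD => Eq1.
by move/(congr1 Posz): Eq; rewrite size_path !PoszD => Eq2; split; lra.
Qed.

Lemma path_equiv_shift P r : good_path k n P.1 -> (r <= size P.1)%N ->
  (k * east P.1 r)%N = r -> path_equiv (shift_path P r) P.
Proof.
move=> good_P le_r Er; apply/path_equivP; exists (- (east P.1 r)%:Z).
split=> z; rewrite mulrN !opprK; first exact: hat_vertices_shift.
apply: hat_labels_shift.
by move: le_r; rewrite size_path -{1}Er leq_pmul2l.
Qed.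

(** The origin is a vertex of the first bi-infinite path, so (-t, -(k-1)t) is a vertex of the
    second. Its offset, reduced modulo the length, is the rotation r. *)
Lemma path_equiv_shiftP P1 P2 : good_path k n P1.1 -> good_path k n P2.1 ->
  path_equiv P1 P2 -> exists r : 'I_(n + k.-1 * n), P1 = shift_path P2 r.
Proof.
move=> good1 good2 /path_equivP[t [Hv Hl]].
have ct1 := good_path_count good1; have ct2 := good_path_count good2.
have N_gt0 : (0 < n + k.-1 * n)%N by rewrite ltn_addr.
have kE : k%:Z = k.-1%:Z + 1 by lia.
have sz1 := size_path P1; have sz2 := size_path P2.
have : hat_vertices P1 (0, 0).
  by apply/hat_verticesP => //; exists 0, 0%N; rewrite east0.
rewrite Hv hat_verticesP //= => -[j0 [m0 [t1 t2]]].
pose r := Ordinal (ltn_pmod m0 N_gt0); pose j := j0 + (m0 %/ size P2.1)%N%:Z.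
have Em0 : m0%:Z + j0 * (size P2.1)%:Z = r%:Z + j * (size P2.1)%:Z.
  by rewrite {1}(divn_eq m0 (n + k.-1 * n)) /r /j /= size_tuple PoszD PoszM;
    lra.
have Ee := east_period Em0; rewrite ct2 in Ee; rewrite sz2 in Em0.
exists r; rewrite [P1]surjective_pairing; congr (_, _).
  apply: val_inj; apply: eq_east => [|m] /=;
    first by rewrite size_rot !size_tuple.
  have le_r : (r <= size P2.1)%N by rewrite size_tuple ltnW.
  apply: (@addnI (east P2.1 r)); rewrite -east_rot //.
  (* Following the m-th vertex of P1 through the translation compares the two east counts. *)
  have : hat_vertices P1 ((east P1.1 m)%:Z, m%:Z - (east P1.1 m)%:Z).
    by apply/hat_verticesP => //; exists 0, m => /=; lia.
  rewrite Hv hat_verticesP //= => -[j2 [m2 [u1 u2]]].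
  have := @east_period P2.1 (r + m) m2 j j2.
  rewrite sz2 ct2 PoszD => H.
  have {}H : (east P2.1 (r + m))%:Z + j * n%:Z = (east P2.1 m2)%:Z + j2 * n%:Z.
    by apply: H; lra.
  by apply/eqP; rewrite -eqz_nat PoszD; apply/eqP; lra.
apply/ffunP => i; rewrite ffunE.
have : hat_labels P1 (k.-1%:Z * (i : nat)%:Z, P1.2 i).
  by exists 0, i; rewrite mul0r add0r.
rewrite Hl => -[j2 [i2 [Ei ->]]]; congr (P2.2 _).
have {}Ei : (i : nat)%:Z - t = j2 * n%:Z + (i2 : nat)%:Z.
  have k0 : k.-1%:Z != 0 by lia.
  by apply: (mulfI k0); rewrite mulrBr.
(* Here -t = [east P2.1 r] + jn, so i + [east P2.1 r] = (j2 - j)n + i2. *)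
apply: val_inj; rewrite /=; apply/esym/(@modn_int n _ _ (j2 - j)) => //.
by rewrite PoszD; lra.
Qed.

Lemma shift_path_good P r : P \in good_paths k n V ->
  (shift_path P r \in good_paths k n V) = good_path k n (rot r P.1).
Proof.
rewrite !inE => /andP[_ /asboolP[g fK gK]] /=; rewrite andb_idr // => _.
apply/asboolP; apply: inj_card_bij.
  by move=> i j; rewrite !ffunE => /(can_inj fK) /ord_shift_inj.
by rewrite (bij_eq_card (Bijective fK gK)).
Qed.

Lemma card_path_class P : P \in good_paths k n V ->
  #|[set Q in good_paths k n V | `[< path_equiv P Q >]]|
    = #|[set r : 'I_(n + k.-1 * n) | good_path k n (rot r P.1)]|.
Proof.
move=> Pin; have := Pin; rewrite inE => /andP[good_P /asboolP[g fK _]].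
set R := [set r : 'I_(n + k.-1 * n) | good_path k n (rot r P.1)].
have R_east (r : 'I_(n + k.-1 * n)) : r \in R -> (k * east P.1 r)%N = r.
  by rewrite inE (good_rotP k_gt0 n_gt0 (size_path P)) ?size_tuple
    ?(ltnW (ltn_ord r)) // => /eqP.
rewrite -(@card_in_imset _ _ (fun r : 'I_(n + k.-1 * n) => shift_path P r) R).
  congr #|pred_of_set _|; apply/setP => Q; rewrite inE.
  apply/andP/imsetP => [[Qin /asboolP PQ]|[r rR ->]].
    have [|//||r EQ] := @path_equiv_shiftP Q P.
    - by move: Qin; rewrite inE => /andP[].
    - exact: path_equiv_sym.
    by exists r; rewrite // inE -(shift_path_good _ Pin) -EQ.
  split; first by rewrite shift_path_good //; move: rR; rewrite inE.
  apply/asboolP/path_equiv_sym; apply: path_equiv_shift => //.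
    by rewrite size_tuple ltnW.
  exact: R_east.
(* The label of index 0 reveals [east P.1 r], which is below n, and r is k times it. *)
move=> r q rR qR [_ /ffunP /(_ (Ordinal n_gt0))].
rewrite !ffunE => /(can_inj fK) /(congr1 val) /=; rewrite !add0n.
have lt_en (u : 'I_(n + k.-1 * n)) : u \in R -> (east P.1 u < n)%N.
  move=> /R_east Eu; rewrite -(ltn_pmul2l k_gt0) Eu.
  by rewrite (leq_trans (ltn_ord u)) // -mulSn prednK.
rewrite !modn_small ?lt_en // => Erq; apply: val_inj.
by rewrite /= -(R_east r) // -(R_east q) // Erq.
Qed.

(** * Counting ornaments *)

Lemma sum_inv_good_rotations :
  \sum_(s : (n + k.-1 * n).-tuple bool | good_path k n s)
     (#|[set r : 'I_(n + k.-1 * n) | good_path k n (rot r s)]|%:R)^-1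
    = 'C(k * n, n)%:R / (k * n)%:R :> rat.
Proof.
have EN : (n + k.-1 * n = k * n)%N by rewrite -mulSn prednK.
have sz (s : (n + k.-1 * n).-tuple bool) :
  size s = (k * n)%N by rewrite size_tuple.
pose X := [set x : (n + k.-1 * n).-tuple bool | count id x == n].
pose A := [set x : (n + k.-1 * n).-tuple bool | good_path k n x].
have := @card_rotations _ _ X A; rewrite card_count_tuple.
rewrite [in 'C(_, _)]EN [X in _ / X%:R]EN => <-.
- apply: eq_big => [s|s _]; first by rewrite inE.
  by congr (#|pred_of_set _|%:R^-1); apply/setP => r; rewrite !inE.
- by rewrite EN muln_gt0 k_gt0.
- apply/subsetP => x; rewrite !inE => /(good_pathP k_gt0 n_gt0 (sz x))[-> _].
  exact: eqxx.
- by move=> r x; rewrite !inE count_rot.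
move=> x; rewrite inE =>
  /eqP /(exists_good_rot k_gt0 n_gt0 (sz x))[r lt_r good_r].
by rewrite size_tuple in lt_r; exists (Ordinal lt_r); rewrite inE.
Qed.

Lemma card_ornament_classes : #|V| = n ->
  #|equivalence_partition (fun P1 P2 => `[< path_equiv P1 P2 >])
      (good_paths k n V)|%:R
    = n`!%:R * ('C(k * n, n)%:R / (k * n)%:R) :> rat.
Proof.
move=> cardV; rewrite (card_equivalence_partition path_equiv_equivalence).
under eq_bigr => P Pin do rewrite (card_path_class Pin).
rewrite -sum_inv_good_rotations.
rewrite (eq_bigl (fun P => good_path k n P.1 && `[< bijective P.2 >]));
  last first.
  by move=> P; rewrite inE.
(* The summand depends on the steps only, so the labelings contribute a factor n!. *)
rewrite -(pair_big (fun s : (n + k.-1 * n).-tuple bool => good_path k n s)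
  (fun f : {ffun 'I_n -> V} => `[< bijective f >])
  (fun s _ =>
    (#|[set r : 'I_(n + k.-1 * n) | good_path k n (rot r s)]|%:R)^-1)) /=.
rewrite mulr_sumr; apply: eq_bigr => s _.
rewrite sumr_const -[LHS]mulr_natl; congr (_%:R * _).
rewrite -ffactnn -[X in X ^_ _]cardV -[X in _ ^_ X](card_ord n) -card_inj_ffuns.
apply: eq_card => f; rewrite inE; apply/asboolP/injectiveP =>
  [/bij_inj //|f_inj].
by apply: inj_card_bij; rewrite // card_ord cardV.
Qed.

End Ornaments.

Lemma card_first_labels n : #|` first_labels n| = n.
Proof. by rewrite card_fseq undup_id ?iota_uniq // size_iota. Qed.

Theorem theorem7 (k : nat) (hk : (2 <= k)%N) : fps_log (G k) = G_circ k.
Proof.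
apply/funext => n; rewrite log_G ?(ltnW hk) // /G_circ; case: eqVneq => // n0.
rewrite /ornaments card_ornament_classes ?card_first_labels ?lt0n //.
  by rewrite [RHS]mulrAC mulfV ?mul1r // pnatr_eq0 -lt0n fact_gt0.
by rewrite -cardfE card_first_labels.
Qed.
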